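(* Let $\Sigma$ be a non-developable ruled surface parametrized by $X:I \times J \to \mathbb{R}^3$ as \[X(t,u) = \alpha(t) + u \beta(t)\] such that the curves $\alpha: I \to \mathbb{R}^3$ and $\beta: I \to \mathbb{S}^2$ are orthogonal and $\beta$ is parametrized by arc length. In addition, suppose that the curvature of $\alpha$ has no zero in $I$. Then $\Sigma$ is a Ricci surface if and only if $\alpha$ has constant torsion $\tau_0 \neq 0$ and $\beta$ is its binormal. Moreover, the constant distribution parameter $\lambda_0$ of $X$ is such that $(\lambda_0\tau_0)^2 = 1$.
   Context: $I,J\subset\mathbb{R}$ are intervals, all curves and maps are smooth, and $X$ is an immersion; $\mathbb{S}^2$ is the unit sphere in $\mathbb{R}^3$ and $\wedge$ is the cross product. The curves $\alpha,\beta$ are called orthogonal (that is, $\alpha$ is the line of striction corresponding to $\beta$) if $\langle\alpha'(t),\beta'(t)\rangle=0$ for all $t\in I$. When $\|\beta\|=\|\beta'\|=1$ and $\alpha,\beta$ are orthogonal, there is a function $\lambda:I\to\mathbb{R}$ with $\alpha'\wedge\beta=\lambda\beta'$, called the distribution parameter of $X$; the surface is developable if $\lambda$ vanishes identically, and non-developable otherwise. The curvature $\kappa$, torsion $\tau$ and Frenet frame $\{T,N,B\}$ of a regular curve $\alpha$ are those computed with respect to an arc length parameter $s$ of $\alpha$ (so $\alpha$ itself need not have unit speed in $t$): $T=\alpha'$, $\alpha''=\kappa N$, $B=T\wedge N$, with the sign convention \[T'=\kappa N,\qquad N'=-\kappa T-\tau B,\qquad B'=\tau N,\] where primes in these formulas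 denote $d/ds$. The vector field $B$ is the binormal of $\alpha$. A Riemannian surface is called a Ricci surface if its Gauss curvature $K$ satisfies $K\Delta K - \|\nabla K\|^2 - 4K^3 = 0$, where $\nabla$ is the gradient and $\Delta$ the Laplace–Beltrami operator (divergence of the gradient); $\Sigma$ carries the metric induced by $X$ from $\mathbb{R}^3$. *)

(* Defs.v *)
(* MathComp / MathComp-Analysis; the real line is an arbitrary R : realType. *)
From HB Require Import structures.
From mathcomp Require Export all_boot all_order all_algebra.
From mathcomp Require Export all_classical all_reals all_analysis.
Export Order.TTheory GRing.Theory Num.Theory.
Export numFieldNormedType.Exports.

#[export] Set Implicit Arguments.
#[export] Unset Strict Implicit.
#[export] Unset Printing Implicit Defensive.

Global Open Scope classical_set_scope.
Global Open Scope ring_scope.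

Section Euclidean.
Variable R : realType.

Definition dot (n : nat) (u v : 'rV[R]_n) : R := \sum_(i < n) u 0 i * v 0 i.

(* The library norm `|u| on 'rV_n is the sup norm. *)
Definition enorm (n : nat) (u : 'rV[R]_n) : R := Num.sqrt (dot u u).

(* Indices are taken modulo 3. *)
Definition cross (u v : 'rV[R]_3) : 'rV[R]_3 :=
  \row_(i < 3) (u 0 (ordS i) * v 0 (ord_pred i)
              - u 0 (ord_pred i) * v 0 (ordS i)).

End Euclidean.

Section Intervals.
Variable R : realType.

(* Open, half-open, closed and unbounded intervals, but not points. *)
Definition nondegenerate_interval (I : set R) : Prop :=
  is_interval I /\ interior I !=set0.

(* Smoothness on an arbitrary subset of R: f is smooth on an open set
   containing I.  When I is a nondegenerate interval, the derivatives of f at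
   the endpoints belonging to I are determined by the values of f on I. *)
Definition smooth_on (V : normedModType R) (I : set R) (f : R -> V) : Prop :=
  exists U : set R, [/\ open U, I `<=` U &
    forall (n : nat) (t : R), U t -> derivable (derive1n n f) t 1].

End Intervals.

(* Frenet apparatus of a regular curve a.  An arc length parameter s of a
   satisfies ds/dt = |a'| or ds/dt = - |a'|; the boolean o selects the
   orientation of s, and derivation with respect to s is (ds/dt)^-1 d/dt.
   Reversing s changes T and B to their opposites, and leaves curvature,
   N and torsion unchanged. *)
Section Frenet.
Variable R : realType.
Implicit Types (o : bool) (a f : R -> 'rV[R]_3).

Definition ds o a f (t : R) : 'rV[R]_3 :=
  ((-1) ^+ o * enorm (derive1 a t))^-1 *: derive1 f t.

Definition tangent o a : R -> 'rV[R]_3 := ds o a a.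

Definition curvature o a (t : R) : R := enorm (ds o a (tangent o a) t).

Definition normal o a (t : R) : 'rV[R]_3 :=
  (curvature o a t)^-1 *: ds o a (tangent o a) t.

Definition binormal o a (t : R) : 'rV[R]_3 :=
  cross (tangent o a t) (normal o a t).

(* Sign convention: dB/ds = tau N and dN/ds = - kappa T - tau B. *)
Definition torsion o a (t : R) : R :=
  dot (ds o a (binormal o a) t) (normal o a t).

End Frenet.

(* Riemannian geometry of a metric g in coordinates (x_0, x_1) = (t, u). *)
Section Riemann.
Variable R : realType.

Definition partial (V : normedModType R) (i : 'I_2) (f : R -> R -> V)
    (t u : R) : V :=
  if i == 0 then derive1 (fun x => f x u) t else derive1 (f t) u.

Variable g : R -> R -> 'M[R]_2.

Definition inverse_metric (t u : R) : 'M[R]_2 := invmx (g t u).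

(* nabla_i d_j = \sum_k Gamma^k_ij d_k *)
Definition christoffel (k i j : 'I_2) (t u : R) : R :=
  2^-1 * \sum_(l < 2) inverse_metric t u k l *
    (partial i (fun x y => g x y j l) t u
     + partial j (fun x y => g x y i l) t u
     - partial l (fun x y => g x y i j) t u).

(* l-th component of R(d_i, d_j) d_k
   = nabla_i nabla_j d_k - nabla_j nabla_i d_k *)
Definition riemann (l k i j : 'I_2) (t u : R) : R :=
  partial i (christoffel l j k) t u - partial j (christoffel l i k) t u
  + \sum_(m < 2) (christoffel l i m t u * christoffel m j k t u
                - christoffel l j m t u * christoffel m i k t u).

(* < R(d_0, d_1) d_1, d_0 > / det g *)
Definition gauss_curvature (t u : R) : R :=
  (\sum_(l < 2) g t u 0 l * riemann l 1 0 1 t u) / \det (g t u).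

Definition gradient (f : R -> R -> R) (i : 'I_2) (t u : R) : R :=
  \sum_(j < 2) inverse_metric t u i j * partial j f t u.

(* Trace of the covariant derivative. *)
Definition divergence (v : 'I_2 -> R -> R -> R) (t u : R) : R :=
  \sum_(i < 2) (partial i (v i) t u
                + \sum_(j < 2) christoffel i i j t u * v j t u).

Definition laplace_beltrami (f : R -> R -> R) : R -> R -> R :=
  divergence (gradient f).

Definition sqnorm (v : 'I_2 -> R -> R -> R) (t u : R) : R :=
  \sum_(i < 2) \sum_(j < 2) g t u i j * v i t u * v j t u.

Definition ricci_metric (I J : set R) : Prop :=
  forall t u : R, I t -> J u ->
    let K := gauss_curvature in
    K t u * laplace_beltrami K t u - sqnorm (gradient K) t u
      - 4 * K t u ^+ 3 = 0.

End Riemann.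

Section Surfaces.
Variable R : realType.
Implicit Types (I J : set R) (X : R -> R -> 'rV[R]_3) (a b : R -> 'rV[R]_3).

Definition immersion I J X : Prop :=
  forall t u : R, I t -> J u ->
    row_free (\matrix_(i < 2) partial i X t u).

Definition induced_metric X (t u : R) : 'M[R]_2 :=
  \matrix_(i < 2, j < 2) dot (partial i X t u) (partial j X t u).

Definition ricci_surface I J X : Prop := ricci_metric (induced_metric X) I J.

Definition ruled a b (t u : R) : 'rV[R]_3 := a t + u *: b t.

Definition regular I a : Prop := forall t : R, I t -> derive1 a t != 0.

Definition orthogonal_curves I a b : Prop :=
  forall t : R, I t -> dot (derive1 a t) (derive1 b t) = 0.

Definition spherical I b : Prop := forall t : R, I t -> enorm (b t) = 1.

Definition unit_speed I b : Prop :=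
  forall t : R, I t -> enorm (derive1 b t) = 1.

Definition distribution_parameter I a b (lam : R -> R) : Prop :=
  forall t : R, I t -> cross (derive1 a t) (b t) = lam t *: derive1 b t.

(* lam is the distribution parameter. *)
Definition developable I (lam : R -> R) : Prop :=
  forall t : R, I t -> lam t = 0.

(* b is the binormal of a, for one of the two orientations of arc length, and
   the torsion of a is the nonzero constant tau0. *)
Definition binormal_of_constant_torsion I a b (tau0 : R) : Prop :=
  tau0 != 0 /\
  exists o : bool,
    forall t : R, I t -> torsion o a t = tau0 /\ b t = binormal o a t.

End Surfaces.

(* Main.v *)
Require Import Defs.
From mathcomp Require Import ring lra.

(** Put F = <alpha', beta> and let L be the distribution parameter.  As beta and
    beta' are orthonormal and alpha' is orthogonal to beta', Lagrange's identity
    gives |alpha'|^2 = F^2 + L^2, so the induced metric is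
      (F^2 + L^2 + u^2) dt^2 + 2 F dt du + du^2,
    whose curvature is K = - L^2 / (L^2 + u^2)^2.  Then
      K Laplacian(K) - |grad K|^2 - 4 K^3 = L^2 P(u) / (L^2 + u^2)^7
    for a polynomial P of degree at most 4 in u, with coefficients in L, L', L'',
    F, F' (ricci_defect_ruled).  On a Ricci surface P vanishes on an interval, so
    wherever L is nonzero all coefficients of P vanish; modulo u^2 + L^2, the
    polynomial P is 12 L^4 (L'^2 - F^2) - 24 F L^3 L' u, and therefore
    L' = F = 0 (ricci_polynomial_vanishing).  Hence (L^2)' = 2 L L' is zero on
    all of I, whether or not L vanishes, and L^2 is constant; since L is not
    identically zero, L is a nonzero constant and F = 0 throughout.  Conversely
    P = 0 when L is constant and F = 0.

    It remains to read these conditions on the Frenet frame.  F = 0 says that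
    beta is orthogonal to T; differentiating <T, beta> = 0 and using
    <T, beta'> = 0 shows that beta is also orthogonal to N, so beta = +B or -B,
    with a constant sign that the orientation of the arc length absorbs
    (director_binormal).  In the other direction, if beta = B then F = 0, and
    T x B = - N turns alpha' x beta = L beta' into L tau = -1
    (binormal_director): L is constant exactly when tau is, and
    (L tau)^2 = 1.

    The interval I may contain endpoints, at which derivatives see values of
    alpha and beta outside I, where the geometric hypotheses need not hold.
    But two functions that are differentiable at t and agree on I have the same
    derivative at t (derive1_unique_within).  Consequently two smooth metrics
    that agree over I have the same Ricci expression over I
    (ricci_defect_congruent), and the computation above can be made for the
    model metric, in which F and L are arbitrary smooth functions on an open
    set.  This requires every intermediate quantity to be differentiable, hence
    a class of smooth functions closed under algebra, square roots and
    differentiation (smooth2). *)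

(** * Derivatives on intervals *)

Section Derivation.
Variable R : realType.
Implicit Types (f g : R -> R) (t x : R).

Lemma is_derive_eq1 f x a b : is_derive x 1 f a -> a = b -> is_derive x 1 f b.
Proof. by move=> ? <-. Qed.

Lemma derive1_val f x a : is_derive x 1 f a -> derive1 f x = a.
Proof. by move=> fa; rewrite derive1E derive_val. Qed.

Lemma interval_small_increment (I : set R) t (e : R) :
  nondegenerate_interval I -> I t -> 0 < e ->
  exists2 h, h != 0 & `|h| < e /\ I (h + t).
Proof.
move=> [iI [c /nbhs_ballP[r /= r0 cI]]] It e0.
have [s st Is] : exists2 s, s != t & I s.
  have [ct|ct] := eqVneq c t; last by exists c => //; apply: cI; apply: ballxx.
  exists (c + r / 2); first by rewrite -ct addrC -subr_eq0 addrK; apply/eqP; lra.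
  apply: cI; rewrite /ball /= opprD addrA subrr add0r normrN gtr0_norm; lra.
have d0 : 0 < `|s - t| by rewrite normr_gt0 subr_eq0.
(* Moving from t towards s stays in I by convexity. *)
pose k := Num.min 1 (e / (2 * `|s - t|)).
have k0 : 0 < k by rewrite /k lt_min ltr01 divr_gt0// mulr_gt0.
have k1 : k <= 1 by rewrite /k ge_min lexx.
exists (k * (s - t)); first by apply: mulf_neq0; [rewrite gt_eqF|rewrite subr_eq0].
split.
  rewrite normrM (gtr0_norm k0).
  have : k * `|s - t| <= e / (2 * `|s - t|) * `|s - t|.
    by rewrite ler_pM2r// /k ge_min lexx orbT.
  have -> : e / (2 * `|s - t|) * `|s - t| = e / 2 by field; rewrite gt_eqF.
  lra.
have [ts|ts] := leP t s.
- by apply: (iI t s) => //; apply/andP; split; nra.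
- by apply: (iI s t) => //; apply/andP; split; nra.
Qed.

(** A derivative is the limit of the difference quotients along any increments
    tending to 0, and [interval_small_increment] provides increments that stay in
    the interval, on one side at least. *)
Lemma derive1_unique_within (I : set R) f g t :
  nondegenerate_interval I -> I t ->
  derivable f t 1 -> derivable g t 1 ->
  (\forall x \near t, I x -> f x = g x) ->
  derive1 f t = derive1 g t.
Proof.
move=> hI It df dg /nbhs_ballP[r /= r0 fg].
apply/eqP; rewrite -subr_eq0 !derive1E -deriveB//.
have db : derivable (f - g) t 1 by apply: derivableB.
apply/negPn/negP; set d := (derive _ _ _) => d0.
have dn : 0 < `|d| by rewrite normr_gt0.
have quotient : _ --> d := db.
move/cvgrPdist_lt : quotient => /(_ _ dn).
rewrite near_withinE => /nbhs_ballP[e /= e0 he].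
have m0 : 0 < Num.min e r by rewrite lt_min e0.
have [h h0 [hm Ih]] := interval_small_increment hI It m0.
move: hm; rewrite lt_min => /andP[h_e hr].
have := he h; rewrite /ball /= sub0r normrN => /(_ h_e h0).
rewrite [h *: 1]mulr1 !fctE.
have -> : f (h + t) = g (h + t).
  by apply: fg => //; rewrite /ball /= opprD addrCA subrr addr0 normrN.
have -> : f t = g t by apply: fg => //; apply: ballxx.
by rewrite !subrr scaler0 subr0 ltxx.
Qed.

Lemma zero_derive1_constant (I : set R) f :
  is_interval I -> (forall t, I t -> is_derive t 1 f 0) ->
  forall s t, I s -> I t -> f s = f t.
Proof.
move=> iI df s t; wlog st : s t / s <= t.
  by move=> H; have [/H|/ltW /H h] := leP s t => // Is It; rewrite h.
move=> Is It.
have Ist x : s <= x <= t -> I x by apply: (iI s t).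
have [x xst||c _] := @MVT_segment R f (fun=> 0) s t st.
- by apply/df/Ist; move: xst; rewrite in_itv /= => /andP[sx xt]; rewrite !ltW.
- by apply: derivable_within_continuous => y; rewrite in_itv /= => /Ist/df[].
by move/eqP; rewrite mul0r subr_eq0 => /eqP.
Qed.

End Derivation.

(** * Smooth functions of two variables *)

Section Partials.
Variable R : realType.
Implicit Types (f g : R -> R -> R) (t u : R) (i : 'I_2).

(** Both partial derivatives are handled at once by abstracting over the index, so
    that each rule of differentiation is stated once. *)
Definition has_partial i f t u (d : R) : Prop :=
  if i == 0 then is_derive t 1 (fun x => f x u) d else is_derive u 1 (f t) d.

Lemma partial_val i f t u d : has_partial i f t u d -> partial i f t u = d.
Proof. by rewrite /has_partial /partial; case: ifP => _ /derive1_val. Qed.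

Lemma has_partial_eq i f t u a b :
  has_partial i f t u a -> a = b -> has_partial i f t u b.
Proof. by move=> ? <-. Qed.

Lemma has_partial_fst (f : R -> R) t u d :
  is_derive t 1 f d -> has_partial 0 (fun x _ => f x) t u d.
Proof. by []. Qed.

Lemma has_partial_fst1 (f : R -> R) t u : has_partial 1 (fun x _ => f x) t u 0.
Proof. exact: is_derive_cst. Qed.

Lemma has_partial_snd t u : has_partial 0 (fun _ y => y) t u 0.
Proof. exact: is_derive_cst. Qed.

Lemma has_partial_snd1 t u : has_partial 1 (fun _ y => y) t u 1.
Proof. exact: is_derive_id. Qed.

Lemma has_partial_cst i (c : R) t u : has_partial i (fun _ _ => c) t u 0.
Proof. by rewrite /has_partial; case: ifP => _; exact: is_derive_cst. Qed.

Lemma has_partialD i f g t u a b :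
  has_partial i f t u a -> has_partial i g t u b ->
  has_partial i (fun x y => f x y + g x y) t u (a + b).
Proof. by rewrite /has_partial; case: ifP => _ ? ?; exact: is_deriveD. Qed.

Lemma has_partialN i f t u a :
  has_partial i f t u a -> has_partial i (fun x y => - f x y) t u (- a).
Proof. by rewrite /has_partial; case: ifP => _ ?; exact: is_deriveN. Qed.

Lemma has_partialM i f g t u a b :
  has_partial i f t u a -> has_partial i g t u b ->
  has_partial i (fun x y => f x y * g x y) t u (a * g t u + f t u * b).
Proof.
rewrite /has_partial; case: ifP => _ fa gb;
  by apply: is_derive_eq1 (is_deriveM fa gb) _; rewrite addrC mulrC.
Qed.

Lemma has_partialV i f t u a : f t u != 0 ->
  has_partial i f t u a ->
  has_partial i (fun x y => (f x y)^-1) t u (- (a * ((f t u)^-1 * (f t u)^-1))).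
Proof.
rewrite /has_partial; case: ifP => _ f0 fa;
  apply: is_derive_eq1; try exact: (is_deriveV f0 fa);
  by rewrite scaleNr [_ *: _]mulrC -exprVn expr2.
Qed.

Lemma has_partial_sqrt i f t u a : 0 < f t u ->
  has_partial i f t u a ->
  has_partial i (fun x y => Num.sqrt (f x y)) t u
    (2^-1 * (Num.sqrt (f t u))^-1 * a).
Proof.
rewrite /has_partial; case: ifP => _ f0 fa;
  have ds := is_derive1_sqrt f0;
  [have := @is_derive1_comp R Num.sqrt (fun x => f x u) t _ _ ds fa
  |have := @is_derive1_comp R Num.sqrt (f t) u _ _ ds fa];
  by rewrite invfM.
Qed.

Lemma has_partial_near i f g t u a :
  (\forall x \near t, f x u = g x u) -> (\forall y \near u, f t y = g t y) ->
  has_partial i f t u a -> has_partial i g t u a.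
Proof.
by rewrite /has_partial => ft fu; case: ifP => _; apply: near_eq_is_derive.
Qed.

End Partials.

Section SmoothFunctions.
Variable R : realType.

(** Partial derivatives see only the coordinate lines through a point, so
    openness along these lines is all that locality arguments need. *)
Definition line_open (Om : R -> R -> Prop) : Prop := forall t u, Om t u ->
  (\forall x \near t, Om x u) /\ (\forall y \near u, Om t y).

Variable Om : R -> R -> Prop.
Implicit Types (f g : R -> R -> R) (t u : R) (i : 'I_2).

Hypothesis Om_open : line_open Om.

Definition eq_on f g : Prop := forall t u, Om t u -> f t u = g t u.

(** [partial] is total, so existence of the derivative has to be required at each
    order. *)
Fixpoint differentiable_upto (n : nat) f : Prop :=
  if n is m.+1 then
    forall i, (forall t u, Om t u -> has_partial i f t u (partial i f t u)) /\
              differentiable_upto m (partial i f)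
  else True.

Definition smooth2 f : Prop := forall n, differentiable_upto n f.

Lemma has_partial_eq_on i f g t u a : Om t u -> eq_on f g ->
  has_partial i f t u a -> has_partial i g t u a.
Proof.
move=> /Om_open[Ot Ou] fg; apply: has_partial_near.
- by apply: filterS Ot => x /fg.
- by apply: filterS Ou => x /fg.
Qed.

Lemma partial_eq_on i f g t u a : Om t u -> eq_on f g ->
  has_partial i f t u a -> partial i g t u = a.
Proof. by move=> Otu fg fa; apply/partial_val/(has_partial_eq_on Otu fg fa). Qed.

Lemma smooth2_has_partial i f t u :
  smooth2 f -> Om t u -> has_partial i f t u (partial i f t u).
Proof. by move=> sf; apply: (sf 1%N i).1. Qed.

Lemma differentiable_upto_eq n f g :
  eq_on f g -> differentiable_upto n f -> differentiable_upto n g.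
Proof.
elim: n f g => // n IHn f g fg df i; have [dfi dpf] := df i.
have part t u : Om t u -> has_partial i g t u (partial i f t u).
  by move=> Otu; apply: has_partial_eq_on Otu fg (dfi _ _ Otu).
have pfg : eq_on (partial i f) (partial i g).
  by move=> t u Otu; rewrite (partial_val (part _ _ Otu)).
by split; [move=> t u Otu; rewrite -pfg//; apply: part|apply: IHn pfg dpf].
Qed.

Lemma smooth2_eq f g : eq_on f g -> smooth2 f -> smooth2 g.
Proof. by move=> fg sf n; apply: differentiable_upto_eq fg (sf n). Qed.

Lemma smooth2_partial i f : smooth2 f -> smooth2 (partial i f).
Proof. by move=> sf n; have [] := sf n.+1 i. Qed.

(** Smoothness as a greatest fixed point: it follows from membership in any
    family that is stable under differentiation. *)
Lemma smooth2_coind (S : (R -> R -> R) -> Prop) :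
  (forall i f, S f -> exists2 g, S g &
     forall t u, Om t u -> has_partial i f t u (g t u)) ->
  forall f, S f -> smooth2 f.
Proof.
move=> step f Sf n; elim: n f Sf => // n IHn f Sf i.
have [g Sg fg] := step i f Sf.
have gE : eq_on g (partial i f) by move=> t u Otu; rewrite (partial_val (fg _ _ Otu)).
split; first by move=> t u Otu; rewrite -gE//; apply: fg.
exact: differentiable_upto_eq gE (IHn _ Sg).
Qed.

(** The closure properties of smooth functions follow all at once by coinduction:
    the family below is stable under differentiation, because the derivative of
    each constructor is again built from the constructors. *)
Inductive generated : (R -> R -> R) -> Prop :=
| gen_smooth f of smooth2 f : generated f
| gen_cst c : generated (fun _ _ => c)
| gen_add f g of generated f & generated g : generated (fun t u => f t u + g t u)
| gen_opp f of generated f : generated (fun t u => - f t u)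
| gen_mul f g of generated f & generated g : generated (fun t u => f t u * g t u)
| gen_inv f of generated f & (forall t u, Om t u -> f t u != 0) :
    generated (fun t u => (f t u)^-1)
| gen_sqrt f of generated f & (forall t u, Om t u -> 0 < f t u) :
    generated (fun t u => Num.sqrt (f t u)).

Lemma generated_smooth f : generated f -> smooth2 f.
Proof.
apply: smooth2_coind => {f} i f; elim=> {f}.
- move=> f sf; exists (partial i f); first exact/gen_smooth/smooth2_partial.
  by move=> t u; apply: smooth2_has_partial.
- move=> c; exists (fun _ _ => 0); first exact: gen_cst.
  by move=> t u _; apply: has_partial_cst.
- move=> f g _ [f' Sf' pf] _ [g' Sg' pg].
  exists (fun t u => f' t u + g' t u); first exact: gen_add.
  by move=> t u Otu; apply: has_partialD; [apply: pf|apply: pg].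
- move=> f _ [f' Sf' pf].
  exists (fun t u => - f' t u); first exact: gen_opp.
  by move=> t u Otu; apply: has_partialN; apply: pf.
- move=> f g Sf [f' Sf' pf] Sg [g' Sg' pg].
  exists (fun t u => f' t u * g t u + f t u * g' t u).
    by apply: gen_add; apply: gen_mul.
  by move=> t u Otu; apply: has_partialM; [apply: pf|apply: pg].
- move=> f Sf [f' Sf' pf] f0.
  exists (fun t u => - (f' t u * ((f t u)^-1 * (f t u)^-1))).
    by apply/gen_opp/gen_mul => //; apply: gen_mul; apply: gen_inv.
  by move=> t u Otu; apply: has_partialV; [apply: f0|apply: pf].
- move=> f Sf [f' Sf' pf] f0.
  exists (fun t u => 2^-1 * (Num.sqrt (f t u))^-1 * f' t u).
    apply: gen_mul => //; apply: gen_mul; first exact: gen_cst.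
    apply: gen_inv; first exact: gen_sqrt.
    by move=> t u Otu; rewrite gt_eqF// sqrtr_gt0 f0.
  by move=> t u Otu; apply: has_partial_sqrt; [apply: f0|apply: pf].
Qed.

Lemma smooth2_cst c : smooth2 (fun _ _ => c).
Proof. exact/generated_smooth/gen_cst. Qed.

Lemma smooth2D f g :
  smooth2 f -> smooth2 g -> smooth2 (fun t u => f t u + g t u).
Proof. by move=> *; apply/generated_smooth/gen_add; apply: gen_smooth. Qed.

Lemma smooth2N f : smooth2 f -> smooth2 (fun t u => - f t u).
Proof. by move=> *; apply/generated_smooth/gen_opp; apply: gen_smooth. Qed.

Lemma smooth2M f g :
  smooth2 f -> smooth2 g -> smooth2 (fun t u => f t u * g t u).
Proof. by move=> *; apply/generated_smooth/gen_mul; apply: gen_smooth. Qed.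

Lemma smooth2V f : (forall t u, Om t u -> f t u != 0) ->
  smooth2 f -> smooth2 (fun t u => (f t u)^-1).
Proof. by move=> ? ?; apply/generated_smooth/gen_inv => //; apply: gen_smooth. Qed.

Lemma smooth2_sqrt f : (forall t u, Om t u -> 0 < f t u) ->
  smooth2 f -> smooth2 (fun t u => Num.sqrt (f t u)).
Proof. by move=> ? ?; apply/generated_smooth/gen_sqrt => //; apply: gen_smooth. Qed.

Lemma smooth2_sum (n : nat) (F : 'I_n -> R -> R -> R) :
  (forall k, smooth2 (F k)) -> smooth2 (fun t u => \sum_(k < n) F k t u).
Proof.
move=> sF; elim: n F sF => [|n IHn] F sF.
  by apply: smooth2_eq (smooth2_cst 0) => t u _; rewrite big_ord0.
apply: smooth2_eq (smooth2D (sF ord0) (IHn _ (fun k => sF (lift ord0 k)))).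
by move=> t u _; rewrite big_ord_recl.
Qed.

Lemma smooth2_snd : smooth2 (fun _ u => u).
Proof.
apply/(@smooth2_coind (fun f => f = (fun _ u => u) \/ exists c, f = fun _ _ => c)).
  move=> i f [->|[c ->]]; last first.
    exists (fun _ _ => 0); first by right; exists 0.
    by move=> t u _; apply: has_partial_cst.
  exists (fun _ _ => (i != 0)%:R); first by right; eexists.
  move=> t u _; have [->|i0] := eqVneq i 0; first exact: has_partial_snd.
  by rewrite /has_partial (negPf i0); exact: is_derive_id.
by left.
Qed.

(** Functions of one variable are regarded as functions of (t, u) that do not
    depend on u, so that curves and surfaces share one notion of smoothness. *)
Lemma smooth2_coord (U : set R) m (a : R -> 'rV[R]_m) n k :
  (forall t u, Om t u -> U t) ->
  (forall n t, U t -> derivable (derive1n n a) t 1) ->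
  smooth2 (fun t _ => derive1n n a t 0 k).
Proof.
move=> OmU da.
apply/(@smooth2_coind (fun f => (exists n, f = (fun t _ => derive1n n a t 0 k)) \/
    f = fun _ _ => 0)); last by left; exists n.
move=> i f [[p ->]|->]; last first.
  exists (fun _ _ => 0); first by right.
  by move=> t u _; apply: has_partial_cst.
have [->|i0] := eqVneq i 0.
  exists (fun t _ => derive1n p.+1 a t 0 k); first by left; exists p.+1.
  move=> t u /OmU Ut; rewrite /has_partial eqxx.
  have dp := da p t Ut.
  apply: DeriveDef; first by move/derivable_mxP: dp.
  by rewrite derive1nS derive1E derive_mx// mxE.
exists (fun _ _ => 0); first by right.
move=> t u _; rewrite /has_partial (negPf i0); exact: is_derive_cst.
Qed.

End SmoothFunctions.

(** * Metrics that agree over an interval *)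

Section TwoByTwo.
Variable R : realType.

Lemma ord2P (i : 'I_2) : i = 0 \/ i = 1.
Proof. by case: i => [[|[|i]] ip] //; [left|right]; apply: val_inj. Qed.

Lemma sum2 (G : 'I_2 -> R) : \sum_(i < 2) G i = G 0 + G 1.
Proof.
rewrite !big_ord_recl big_ord0 addr0; congr (_ + G _); exact: val_inj.
Qed.

Lemma det2 (A : 'M[R]_2) : \det A = A 0 0 * A 1 1 - A 0 1 * A 1 0.
Proof.
have e (i : 'I_1) : lift ord0 i = 1 :> 'I_2 by rewrite ord1; apply/val_inj.
rewrite (expand_det_row _ 0) !big_ord_recl big_ord0 /cofactor !det_mx11 !mxE /=.
rewrite !e (_ : lift 1 0 = 0 :> 'I_2); last exact: val_inj.
rewrite (_ : ord0 = 0 :> 'I_2)// /bump /=; ring.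
Qed.

Lemma invmx2 (A : 'M[R]_2) : \det A != 0 ->
  [/\ invmx A 0 0 = (\det A)^-1 * A 1 1, invmx A 0 1 = (\det A)^-1 * - A 0 1,
      invmx A 1 0 = (\det A)^-1 * - A 1 0 & invmx A 1 1 = (\det A)^-1 * A 0 0].
Proof.
move=> dA.
pose B : 'M[R]_2 := \matrix_(i, j) ((\det A)^-1 *
  (if i == 0 then if j == 0 then A 1 1 else - A 0 1
   else if j == 0 then - A 1 0 else A 0 0)).
have AB : A *m B = 1%:M.
  have d1 : (\det A)^-1 * (A 0 0 * A 1 1 - A 0 1 * A 1 0) = 1.
    by rewrite -det2 mulVf.
  apply/matrixP => i j; rewrite mxE sum2 !mxE.
  by case: (ord2P i) => ->; case: (ord2P j) => -> /=; rewrite -?d1; ring.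
have uA : A \in unitmx by rewrite unitmxE unitfE.
have -> : invmx A = B by rewrite -[B]mul1mx -(mulVmx uA) -mulmxA AB mulmx1.
by rewrite !mxE.
Qed.

End TwoByTwo.

Section Congruence.
Variables (R : realType) (I : set R) (Om : R -> R -> Prop).
Hypothesis hI : nondegenerate_interval I.
Hypothesis Om_open : line_open Om.
Implicit Types (f g : R -> R -> R) (i : 'I_2).

(** Agreement over I only, between functions that are smooth on a neighbourhood:
    the relation survives differentiation in t up to the endpoints of I
    (see [congruent_partial]), so everything computed from two congruent metrics
    is congruent. *)
Definition congruent f g : Prop :=
  [/\ smooth2 Om f, smooth2 Om g & forall t u, I t -> Om t u -> f t u = g t u].

Lemma congruent_cst c : congruent (fun _ _ => c) (fun _ _ => c).
Proof. by split=> //; apply: smooth2_cst. Qed.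

Lemma congruentD f f' g g' : congruent f f' -> congruent g g' ->
  congruent (fun t u => f t u + g t u) (fun t u => f' t u + g' t u).
Proof.
move=> [sf sf' ff'] [sg sg' gg']; split; try exact: smooth2D.
by move=> t u It Otu; rewrite ff'// gg'.
Qed.

Lemma congruentN f f' : congruent f f' ->
  congruent (fun t u => - f t u) (fun t u => - f' t u).
Proof.
move=> [sf sf' ff']; split; try exact: smooth2N.
by move=> t u It Otu; rewrite ff'.
Qed.

Lemma congruentM f f' g g' : congruent f f' -> congruent g g' ->
  congruent (fun t u => f t u * g t u) (fun t u => f' t u * g' t u).
Proof.
move=> [sf sf' ff'] [sg sg' gg']; split; try exact: smooth2M.
by move=> t u It Otu; rewrite ff'// gg'.
Qed.

Lemma congruentV f f' :
  (forall t u, Om t u -> f t u != 0) -> (forall t u, Om t u -> f' t u != 0) ->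
  congruent f f' -> congruent (fun t u => (f t u)^-1) (fun t u => (f' t u)^-1).
Proof.
move=> f0 f'0 [sf sf' ff']; split; try exact: smooth2V.
by move=> t u It Otu; rewrite ff'.
Qed.

Lemma congruent_sum n (F G : 'I_n -> R -> R -> R) :
  (forall k, congruent (F k) (G k)) ->
  congruent (fun t u => \sum_(k < n) F k t u) (fun t u => \sum_(k < n) G k t u).
Proof.
move=> FG; split; try by apply: smooth2_sum => // k; case: (FG k).
by move=> t u It Otu; apply: eq_bigr => k _; case: (FG k) => _ _ ->.
Qed.

Lemma congruent_partial i f g :
  congruent f g -> congruent (partial i f) (partial i g).
Proof.
move=> [sf sg fg]; split; try exact: smooth2_partial.
move=> t u It Otu.
have pf := smooth2_has_partial i sf Otu.
have pg := smooth2_has_partial i sg Otu.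
have [Ot Ou] := Om_open Otu.
move: pf pg; rewrite /has_partial /partial; case: ifP => _ pf pg.
- apply: (derive1_unique_within hI It); try by [case: pf|case: pg].
  by apply: filterS Ot => x Oxu Ix; apply: fg.
- rewrite !derive1E; apply: near_eq_derive.
  by apply: filterS Ou => y Oty; apply: fg.
Qed.

Lemma congruent_eq_on f f' g g' : eq_on Om f f' -> eq_on Om g g' ->
  congruent f g -> congruent f' g'.
Proof.
move=> ff' gg' [sf sg fg]; split.
- exact: smooth2_eq ff' sf.
- exact: smooth2_eq gg' sg.
by move=> t u It Otu; rewrite -ff'// -gg'// fg.
Qed.

Variables g h : R -> R -> 'M[R]_2.
Hypothesis gh : forall i j : 'I_2,
  congruent (fun t u => g t u i j) (fun t u => h t u i j).
Hypothesis dg : forall t u, Om t u -> \det (g t u) != 0.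
Hypothesis dh : forall t u, Om t u -> \det (h t u) != 0.

Lemma congruent_det :
  congruent (fun t u => \det (g t u)) (fun t u => \det (h t u)).
Proof.
apply: (@congruent_eq_on (fun t u => g t u 0 0 * g t u 1 1 - g t u 0 1 * g t u 1 0) _
  (fun t u => h t u 0 0 * h t u 1 1 - h t u 0 1 * h t u 1 0)).
- by move=> t u _; rewrite det2.
- by move=> t u _; rewrite det2.
by apply: congruentD; [|apply: congruentN]; apply: congruentM.
Qed.

Lemma congruent_inverse_metric (k l : 'I_2) :
  congruent (fun t u => inverse_metric g t u k l)
            (fun t u => inverse_metric h t u k l).
Proof.
have cV := congruentV dg dh congruent_det.
by case: (ord2P k) => ->; case: (ord2P l) => ->; (apply: congruent_eq_on;
  [move=> t u /dg /invmx2[e1 e2 e3 e4]; rewrite /inverse_metric ?e1 ?e2 ?e3 ?e4; reflexivity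
  |move=> t u /dh /invmx2[e1 e2 e3 e4]; rewrite /inverse_metric ?e1 ?e2 ?e3 ?e4; reflexivity
  |apply: congruentM => //; try apply: congruentN]).
Qed.

Lemma congruent_christoffel (k i j : 'I_2) :
  congruent (christoffel g k i j) (christoffel h k i j).
Proof.
rewrite /christoffel; apply: congruentM; first exact: congruent_cst.
apply: congruent_sum => l; apply: congruentM; first exact: congruent_inverse_metric.
by apply: congruentD; [apply: congruentD|apply: congruentN];
  apply: congruent_partial.
Qed.

Lemma congruent_gauss_curvature :
  congruent (gauss_curvature g) (gauss_curvature h).
Proof.
apply: congruentM; last exact: (congruentV dg dh congruent_det).
apply: congruent_sum => l; apply: congruentM => //.
apply: congruentD; first by apply: congruentD; [|apply: congruentN];
  apply: congruent_partial; apply: congruent_christoffel.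
by apply: congruent_sum => m; apply: congruentD; [|apply: congruentN];
  apply: congruentM; apply: congruent_christoffel.
Qed.

Lemma congruent_gradient f f' i :
  congruent f f' -> congruent (gradient g f i) (gradient h f' i).
Proof.
move=> ff'; apply: congruent_sum => j; apply: congruentM.
- exact: congruent_inverse_metric.
- exact: congruent_partial.
Qed.

Lemma congruent_laplace_beltrami f f' :
  congruent f f' -> congruent (laplace_beltrami g f) (laplace_beltrami h f').
Proof.
move=> ff'; apply: congruent_sum => i; apply: congruentD.
  exact/congruent_partial/congruent_gradient.
apply: congruent_sum => j; apply: congruentM.
- exact: congruent_christoffel.
- exact: congruent_gradient.
Qed.

(** The Ricci condition says that this expression vanishes. *)
Definition ricci_defect (m : R -> R -> 'M[R]_2) t u : R :=
  let K := gauss_curvature m in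
  K t u * laplace_beltrami m K t u - sqnorm m (gradient m K) t u
    - 4 * K t u ^+ 3.

Lemma ricci_defect_congruent t u :
  I t -> Om t u -> ricci_defect g t u = ricci_defect h t u.
Proof.
move=> It Otu; have cK := congruent_gauss_curvature.
have [_ _ KE] := cK; have [_ _ LE] := congruent_laplace_beltrami cK.
rewrite /ricci_defect /sqnorm; congr (_ * _ - _ - 4 * _ ^+ 3).
- exact: KE.
- exact: LE.
- apply: eq_bigr => i _; apply: eq_bigr => j _.
  have [_ _ gE] := gh i j.
  have [_ _ viE] := congruent_gradient i cK.
  have [_ _ vjE] := congruent_gradient j cK.
  by congr (_ * _ * _); [apply: gE|apply: viE|apply: vjE].
- exact: KE.
Qed.

End Congruence.

(** * The Ricci expression of a ruled metric *)

Section Model.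
Variable R : realType.
Variables (F L F1 L1 L2 : R -> R) (Om : R -> R -> Prop).
Hypothesis Om_open : line_open Om.
Hypothesis dF : forall t u, Om t u -> is_derive t 1 F (F1 t).
Hypothesis dL : forall t u, Om t u -> is_derive t 1 L (L1 t).
Hypothesis dL1 : forall t u, Om t u -> is_derive t 1 L1 (L2 t).
Hypothesis D0 : forall t u, Om t u -> L t * L t + u * u != 0.

(* Every quantity below is polynomial in the inverse determinant q. *)
Let q t u : R := (L t * L t + u * u)^-1.

(** The metric induced on a ruled surface, with F = <alpha', beta> and L the
    distribution parameter; here F and L are arbitrary functions. *)
Definition ruled_metric t u : 'M[R]_2 := \matrix_(i < 2, j < 2)
  (if i == 0 then if j == 0 then F t * F t + L t * L t + u * u else F t
   else if j == 0 then F t else 1).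

Lemma ruled_metricE :
  [/\ (fun t u => ruled_metric t u 0 0) = (fun t u => F t * F t + L t * L t + u * u),
      (fun t u => ruled_metric t u 0 1) = (fun t u => F t),
      (fun t u => ruled_metric t u 1 0) = (fun t u => F t) &
      (fun t u => ruled_metric t u 1 1) = (fun t u => 1)].
Proof. by split; apply/funext => t; apply/funext => u; rewrite mxE. Qed.

Lemma det_ruled_metric t u : \det (ruled_metric t u) = L t * L t + u * u.
Proof. rewrite det2 !mxE /=; ring. Qed.

Lemma q_partial0 t u : Om t u ->
  has_partial 0 q t u (- 2 * (L t * L1 t) * (q t u * q t u)).
Proof.
move=> Ot; apply: has_partial_eq.
  apply: has_partialV; first exact: D0.
  by apply: has_partialD; apply: has_partialM;
    first [apply: has_partial_snd|apply: has_partial_fst; exact: dL Ot].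
rewrite /q /=; ring.
Qed.

Lemma q_partial1 t u : Om t u -> has_partial 1 q t u (- 2 * u * (q t u * q t u)).
Proof.
move=> Ot; apply: has_partial_eq.
  apply: has_partialV; first exact: D0.
  by apply: has_partialD; apply: has_partialM;
    first [apply: has_partial_snd1|apply: has_partial_fst1].
rewrite /q /=; ring.
Qed.

Ltac differentiate Ot := repeat first
  [ exact: (q_partial0 Ot) | exact: (q_partial1 Ot)
  | apply: has_partialD | apply: has_partialN | apply: has_partialM
  | apply: has_partial_cst | apply: has_partial_snd | apply: has_partial_snd1
  | apply: has_partial_fst1
  | apply: has_partial_fst; first [exact: (dF Ot)|exact: (dL Ot)|exact: (dL1 Ot)] ].

Lemma inverse_ruled_metric t u : Om t u ->
  [/\ inverse_metric ruled_metric t u 0 0 = q t u,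
      inverse_metric ruled_metric t u 0 1 = - F t * q t u,
      inverse_metric ruled_metric t u 1 0 = - F t * q t u &
      inverse_metric ruled_metric t u 1 1 =
        (F t * F t + L t * L t + u * u) * q t u].
Proof.
move=> /D0; rewrite -det_ruled_metric => /invmx2; rewrite det_ruled_metric -/(q t u).
by rewrite !mxE /= mulr1 ![_^-1 * _]mulrC.
Qed.

Lemma partial_ruled_metric t u : Om t u ->
  [/\ partial 0 (fun x y => ruled_metric x y 0 0) t u = 2 * (F t * F1 t + L t * L1 t),
      partial 1 (fun x y => ruled_metric x y 0 0) t u = 2 * u,
      partial 0 (fun x y => ruled_metric x y 0 1) t u = F1 t &
      partial 1 (fun x y => ruled_metric x y 0 1) t u = 0] /\
  [/\ partial 0 (fun x y => ruled_metric x y 1 0) t u = F1 t,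
      partial 1 (fun x y => ruled_metric x y 1 0) t u = 0,
      partial 0 (fun x y => ruled_metric x y 1 1) t u = 0 &
      partial 1 (fun x y => ruled_metric x y 1 1) t u = 0].
Proof.
move=> Ot; have [-> -> -> ->] := ruled_metricE; split; split;
  apply: partial_val; (apply: has_partial_eq; [by differentiate Ot|rewrite /=; ring]).
Qed.

(** The symbols that enter the curvature and the divergence. *)
Lemma christoffel_ruled_metric t u : Om t u ->
  [/\ christoffel ruled_metric 0 0 0 t u = (L t * L1 t + F t * u) * q t u,
      christoffel ruled_metric 0 0 1 t u = u * q t u,
      christoffel ruled_metric 0 1 0 t u = u * q t u &
      christoffel ruled_metric 0 1 1 t u = 0] /\
  [/\ christoffel ruled_metric 1 0 1 t u = - (F t * u) * q t u,
      christoffel ruled_metric 1 1 0 t u = - (F t * u) * q t u &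
      christoffel ruled_metric 1 1 1 t u = 0].
Proof.
move=> Ot; have D := D0 Ot.
have [i1 i2 i3 i4] := inverse_ruled_metric Ot.
have [[p1 p2 p3 p4] [p5 p6 p7 p8]] := partial_ruled_metric Ot.
rewrite /christoffel; split; split;
  rewrite !sum2 ?i1 ?i2 ?i3 ?i4 ?p1 ?p2 ?p3 ?p4 ?p5 ?p6 ?p7 ?p8;
  rewrite /q; by field.
Qed.

Lemma gauss_curvature_ruled_metric t u : Om t u ->
  gauss_curvature ruled_metric t u =
  - (L t * L t) * (q t u * q t u).
Proof.
move=> Ot; have D := D0 Ot; rewrite /gauss_curvature det_ruled_metric.
have [[c1 c2 c3 c4] [c5 c6 c7]] := christoffel_ruled_metric Ot.
have p011 : partial 0 (christoffel ruled_metric 0 1 1) t u = 0.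
  apply: (@partial_eq_on _ _ Om_open _ (fun _ _ => 0)) (Ot) _ (has_partial_cst _ _ _ _).
  by move=> x y /christoffel_ruled_metric[[_ _ _ ->]].
have p111 : partial 0 (christoffel ruled_metric 1 1 1) t u = 0.
  apply: (@partial_eq_on _ _ Om_open _ (fun _ _ => 0)) (Ot) _ (has_partial_cst _ _ _ _).
  by move=> x y /christoffel_ruled_metric[_ [_ _ ->]].
have p001 : partial 1 (christoffel ruled_metric 0 0 1) t u =
    (L t * L t - u * u) * (q t u * q t u).
  apply: (@partial_eq_on _ _ Om_open _ (fun x y => y * q x y)) (Ot) _ _.
    by move=> x y /christoffel_ruled_metric[[_ -> _ _]].
  by apply: has_partial_eq; [differentiate Ot|rewrite /= /q; field].
have p101 : partial 1 (christoffel ruled_metric 1 0 1) t u =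
    - F t * (L t * L t - u * u) * (q t u * q t u).
  apply: (@partial_eq_on _ _ Om_open _ (fun x y => - (F x * y) * q x y)) (Ot) _ _.
    by move=> x y /christoffel_ruled_metric[_ [-> _ _]].
  by apply: has_partial_eq; [differentiate Ot|rewrite /= /q; field].
rewrite sum2 /riemann !sum2 p011 p111 p001 p101 c1 c2 c3 c4 c5 c6 c7 !mxE /=.
by rewrite /q; field.
Qed.

(** The numerator of the Ricci expression of [ruled_metric], where l1, l2 and f1
    stand for L', L'' and F'.  It is written along powers of l^2 + u^2, which
    isolates in the last two terms the remainder modulo l^2 + u^2. *)
Definition ricci_polynomial (l l1 l2 f f1 u : R) : R :=
  2 * (l2 * l - l1 ^+ 2) * (l ^+ 2 + u ^+ 2) ^+ 2
  + (l ^+ 2 + u ^+ 2) * (- 6 * l ^+ 2 * l1 ^+ 2 - 4 * l ^+ 3 * l2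
      + 8 * l ^+ 2 * f ^+ 2 + (4 * f1 * l ^+ 2 + 2 * f * l * l1) * u)
  + 12 * l ^+ 4 * (l1 ^+ 2 - f ^+ 2) - 24 * f * l ^+ 3 * l1 * u.

(** A direct computation: the gradient of K has components v0 and v1, whose
    derivatives are polynomial in q, and the identity holds modulo
    q (L^2 + u^2) = 1. *)
Lemma ricci_defect_ruled_metric t u : Om t u ->
  ricci_defect ruled_metric t u =
  L t ^+ 2 * q t u ^+ 7 *
  ricci_polynomial (L t) (L1 t) (L2 t) (F t) (F1 t) u.
Proof.
have KE : eq_on Om (fun x y => - (L x * L x) * (q x y * q x y))
     (gauss_curvature ruled_metric).
  by move=> x y /gauss_curvature_ruled_metric ->.
have K0E x y : Om x y -> partial 0 (gauss_curvature ruled_metric) x y =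
    - 2 * (L x * L1 x) * q x y ^+ 2 + 4 * L x ^+ 3 * L1 x * q x y ^+ 3.
  move=> Oxy; apply: (partial_eq_on Om_open Oxy KE).
  by apply: has_partial_eq; [differentiate Oxy|rewrite /=; ring].
have K1E x y : Om x y -> partial 1 (gauss_curvature ruled_metric) x y =
    4 * L x ^+ 2 * y * q x y ^+ 3.
  move=> Oxy; apply: (partial_eq_on Om_open Oxy KE).
  by apply: has_partial_eq; [differentiate Oxy|rewrite /=; ring].
pose v0 x y := - 2 * (L x * L1 x) * (q x y * q x y * q x y)
  + (4 * (L x * L x * L x * L1 x) - 4 * (F x * (L x * L x) * y))
    * (q x y * q x y * q x y * q x y).
pose v1 x y := (2 * (F x * (L x * L1 x)) + 4 * (L x * L x * y)) * (q x y * q x y * q x y)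
  + (4 * (F x * F x * (L x * L x) * y) - 4 * (F x * (L x * L x * L x * L1 x)))
    * (q x y * q x y * q x y * q x y).
have v0E : eq_on Om v0 (gradient ruled_metric (gauss_curvature ruled_metric) 0).
  move=> x y Oxy; rewrite /gradient sum2 K0E// K1E//.
  have [-> -> _ _] := inverse_ruled_metric Oxy; rewrite /v0; ring.
have v1E : eq_on Om v1 (gradient ruled_metric (gauss_curvature ruled_metric) 1).
  move=> x y Oxy; rewrite /gradient sum2 K0E// K1E//; have Dxy := D0 Oxy.
  have [_ _ -> ->] := inverse_ruled_metric Oxy; rewrite /v1 /q; by field.
move=> Ot; have D := D0 Ot.
have [[c1 c2 c3 c4] [c5 c6 c7]] := christoffel_ruled_metric Ot.
have p0 : partial 0 (gradient ruled_metric (gauss_curvature ruled_metric) 0) t u =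
  - 2 * (L1 t ^+ 2 + L t * L2 t) * q t u ^+ 3
  + (24 * L t ^+ 2 * L1 t ^+ 2 + 4 * L t ^+ 3 * L2 t - 4 * F1 t * L t ^+ 2 * u
     - 8 * F t * L t * L1 t * u) * q t u ^+ 4
  - 8 * L t * L1 t * (4 * L t ^+ 3 * L1 t - 4 * F t * L t ^+ 2 * u) * q t u ^+ 5.
  apply: (partial_eq_on Om_open Ot v0E).
  by apply: has_partial_eq; [rewrite /v0; differentiate Ot|rewrite /=; ring].
have p1 : partial 1 (gradient ruled_metric (gauss_curvature ruled_metric) 1) t u =
  4 * L t ^+ 2 * q t u ^+ 3
  + (4 * F t ^+ 2 * L t ^+ 2 - 6 * u * (2 * F t * L t * L1 t + 4 * L t ^+ 2 * u)) * q t u ^+ 4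
  - 8 * u * (4 * F t ^+ 2 * L t ^+ 2 * u - 4 * F t * L t ^+ 3 * L1 t) * q t u ^+ 5.
  apply: (partial_eq_on Om_open Ot v1E).
  by apply: has_partial_eq; [rewrite /v1; differentiate Ot|rewrite /=; ring].
rewrite /ricci_defect /laplace_beltrami /divergence /sqnorm !sum2 p0 p1 -KE//.
rewrite -v0E// -v1E// c1 c2 c6 c7 !mxE /= /v0 /v1 /ricci_polynomial.
(* Oriented so that rewriting eliminates every monomial divisible by u^2 q. *)
have uuq : u ^+ 2 * q t u = 1 - L t ^+ 2 * q t u by rewrite /q; field.
ring: uuq.
Qed.

End Model.

Section Roots.
Variable R : realType.

Lemma poly_vanishing_on_interval (J : set R) (p : {poly R}) :
  nondegenerate_interval J -> (forall u, J u -> p.[u] = 0) -> p = 0.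
Proof.
move=> [_ [c /nbhs_ballP[r /= r0 cJ]]] pJ; apply/eqP/negPn/negP => p0.
pose s := [seq c + r / k.+2%:R | k <- iota 0 (size p)].
have : (size s < size p)%N; last by rewrite size_map size_iota ltnn.
apply: max_poly_roots p0 _ _.
- apply/allP => x /mapP[k _ ->]; apply/rootP/pJ/cJ.
  rewrite /ball /= opprD addrA subrr add0r normrN gtr0_norm ?divr_gt0//.
  by rewrite ltr_pdivrMr// ltr_pMr// ltr1n.
- rewrite map_inj_uniq ?iota_uniq// => j k /addrI /(mulfI (lt0r_neq0 r0)) /invr_inj /eqP.
  by rewrite eqr_nat => /eqP[].
Qed.

(** Modulo u^2 + l^2 only the terms G + H u below survive, so G = H = 0, that is,
    l1^2 = f^2 and f l1 = 0.  Read with u = i l, the remainder is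
    12 l^4 (l1 - i f)^2. *)
Lemma ricci_polynomial_vanishing (J : set R) (l l1 l2 f f1 : R) :
  nondegenerate_interval J -> l != 0 ->
  (forall u, J u -> ricci_polynomial l l1 l2 f f1 u = 0) -> l1 = 0 /\ f = 0.
Proof.
move=> hJ l0 PJ.
(* P(u) = A (l^2 + u^2)^2 + (l^2 + u^2) (B + C u) + G + H u. *)
pose A := 2 * (l2 * l - l1 ^+ 2).
pose B := - 6 * l ^+ 2 * l1 ^+ 2 - 4 * l ^+ 3 * l2 + 8 * l ^+ 2 * f ^+ 2.
pose C := 4 * f1 * l ^+ 2 + 2 * f * l * l1.
pose G := 12 * l ^+ 4 * (l1 ^+ 2 - f ^+ 2).
pose H := - (24 * f * l ^+ 3 * l1).
pose p : {poly R} := Poly [:: A * l ^+ 4 + B * l ^+ 2 + G; C * l ^+ 2 + H;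
  2 * A * l ^+ 2 + B; C; A].
have p0 : p = 0.
  apply: poly_vanishing_on_interval hJ _ => u Ju.
  apply: etrans (PJ u Ju).
  by rewrite horner_Poly /= /ricci_polynomial /A /B /C /G /H; ring.
have coef k : p`_k = 0 by rewrite p0 coef0.
have A0 : A = 0 by have := coef 4%N; rewrite coef_Poly.
have C0 : C = 0 by have := coef 3%N; rewrite coef_Poly.
have B0 : B = 0 by have := coef 2%N; rewrite coef_Poly /= A0 mulr0 mul0r add0r.
have H0 : H = 0 by have := coef 1%N; rewrite coef_Poly /= C0 mul0r add0r.
have G0 : G = 0 by have := coef 0%N; rewrite coef_Poly /= A0 B0 !mul0r !add0r.
have fl1 : f * l1 = 0.
  have lN : 24 * l ^+ 3 != 0 by rewrite mulf_neq0 ?expf_neq0// pnatr_eq0.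
  by apply: (mulfI lN); rewrite mulr0 -[RHS]oppr0 -H0 /H; ring.
have l1f : l1 ^+ 2 = f ^+ 2.
  have lN : 12 * l ^+ 4 != 0 by rewrite mulf_neq0 ?expf_neq0// pnatr_eq0.
  by apply/eqP; rewrite -subr_eq0; apply/eqP/(mulfI lN); rewrite mulr0.
have l10 : l1 = 0.
  move/eqP: fl1; rewrite mulf_eq0 => /orP[/eqP f0|/eqP//].
  by apply/eqP; rewrite -sqrf_eq0 l1f f0 expr0n.
by split=> //; apply/eqP; rewrite -sqrf_eq0 -l1f l10 expr0n.
Qed.

End Roots.

(** * Vector algebra in space *)

Section Space.
Variable R : realType.
Implicit Types (u v w : 'rV[R]_3) (c : R).

Lemma dot3 u v : dot u v = u 0 0 * v 0 0 + u 0 1 * v 0 1 + u 0 2 * v 0 2.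
Proof.
rewrite /dot !big_ord_recl big_ord0 addr0 addrA.
by congr (_ + u _ _ * v _ _ + u _ _ * v _ _); apply: val_inj.
Qed.

Lemma cross3 u v :
  [/\ cross u v 0 0 = u 0 1 * v 0 2 - u 0 2 * v 0 1,
      cross u v 0 1 = u 0 2 * v 0 0 - u 0 0 * v 0 2 &
      cross u v 0 2 = u 0 0 * v 0 1 - u 0 1 * v 0 0].
Proof.
by split; rewrite mxE; congr (u _ _ * v _ _ - u _ _ * v _ _); apply: val_inj.
Qed.

Lemma vec3P u v :
  u 0 0 = v 0 0 -> u 0 1 = v 0 1 -> u 0 2 = v 0 2 -> u = v.
Proof.
move=> e0 e1 e2; apply/rowP => -[[|[|[|k]]] kp] //.
- by rewrite (_ : Ordinal kp = 0) //; apply: val_inj.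
- by rewrite (_ : Ordinal kp = 1) //; apply: val_inj.
- by rewrite (_ : Ordinal kp = 2) //; apply: val_inj.
Qed.

Lemma coordD u v k : (u + v) 0 k = u 0 k + v 0 k. Proof. exact: mxE. Qed.
Lemma coordN u k : (- u) 0 k = - u 0 k. Proof. exact: mxE. Qed.
Lemma coordZ c u k : (c *: u) 0 k = c * u 0 k. Proof. exact: mxE. Qed.

Ltac coordinates := rewrite ?dot3 ?coordD ?coordN ?coordZ;
  repeat match goal with
  | |- context [cross ?u ?v] => let a := fresh in let b := fresh in
      let c := fresh in have [a b c] := cross3 u v; rewrite ?a ?b ?c; clear a b c
  end; rewrite ?coordD ?coordN ?coordZ.

Lemma dotC u v : dot u v = dot v u.
Proof. by coordinates; ring. Qed.

Lemma dotDl u v w : dot (u + v) w = dot u w + dot v w.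
Proof. by coordinates; ring. Qed.

Lemma dotZl c u v : dot (c *: u) v = c * dot u v.
Proof. by coordinates; ring. Qed.

Lemma dotDr u v w : dot w (u + v) = dot w u + dot w v.
Proof. by coordinates; ring. Qed.

Lemma dotZr c u v : dot v (c *: u) = c * dot v u.
Proof. by coordinates; ring. Qed.

Lemma crossZl c u v : cross (c *: u) v = c *: cross u v.
Proof. by apply: vec3P; coordinates; ring. Qed.

Lemma crossNl u v : cross (- u) v = - cross u v.
Proof. by apply: vec3P; coordinates; ring. Qed.

Lemma dot_cross u v : dot u (cross u v) = 0.
Proof. by coordinates; ring. Qed.

Lemma double_cross u v w : cross u (cross v w) = dot u w *: v - dot u v *: w.
Proof. by apply: vec3P; coordinates; ring. Qed.

Lemma dot_cross_cross u v :
  dot (cross u v) (cross u v) = dot u u * dot v v - dot u v ^+ 2.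
Proof. by coordinates; ring. Qed.

Lemma dotvv_ge0 u : 0 <= dot u u.
Proof. by rewrite dot3; rewrite !addr_ge0// -expr2 sqr_ge0. Qed.

Lemma dotvv_eq0 u : (dot u u == 0) = (u == 0).
Proof.
apply/idP/eqP => [|->]; last by rewrite dot3 !mxE !mul0r !addr0.
rewrite dot3 -!expr2 !paddr_eq0 ?addr_ge0 ?sqr_ge0// !sqrf_eq0.
by move=> /andP[/andP[/eqP e0 /eqP e1] /eqP e2]; apply: vec3P; rewrite mxE.
Qed.

Lemma enorm_sq u : enorm u ^+ 2 = dot u u.
Proof. by rewrite sqr_sqrtr// dotvv_ge0. Qed.

Lemma enorm_eq0 u : (enorm u == 0) = (u == 0).
Proof. by rewrite -sqrf_eq0 enorm_sq dotvv_eq0. Qed.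

(** A vector orthogonal to two orthonormal vectors has zero cross product with
    their cross product, by the double cross product formula, and is therefore
    parallel to it. *)
Lemma parallel_cross u v w : dot u u = 1 -> dot v v = 1 -> dot u v = 0 ->
  dot w u = 0 -> dot w v = 0 -> w = dot w (cross u v) *: cross u v.
Proof.
move=> uu vv uv wu wv.
have nn : dot (cross u v) (cross u v) = 1.
  by rewrite dot_cross_cross uu vv uv mulr1 expr0n subr0.
have nw : cross w (cross u v) = 0 by rewrite double_cross wu wv !scale0r subr0.
have := double_cross (cross u v) w (cross u v).
rewrite nw nn scale1r [dot (cross u v) w]dotC => /esym/eqP.
rewrite (_ : cross _ 0 = 0) ?subr_eq0; first by move/eqP.
by apply: vec3P; coordinates; rewrite !mxE; ring.
Qed.

End Space.

(** * Smooth curves and vector fields *)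

Section SmoothVectors.
Variable R : realType.
Implicit Types (f g : R -> R -> R) (v w : R -> R -> 'rV[R]_3) (t u : R).

Lemma smooth2_mono (Om Om' : R -> R -> Prop) f :
  (forall t u, Om' t u -> Om t u) -> smooth2 Om f -> smooth2 Om' f.
Proof.
move=> sub sf n; elim: n f {sf}(sf n) => // n IHn f df i.
by have [dfi dpf] := df i; split; [move=> t u /sub/dfi|apply: IHn].
Qed.

Lemma near_neq0 (f : R -> R) t d :
  is_derive t 1 f d -> f t != 0 -> \forall x \near t, f x != 0.
Proof.
move=> [df _]; have /differentiable_continuous fc : differentiable f t.
  exact/derivable1_diffP.
by move=> ft0; apply: (cvgr_neq0 _ fc ft0).
Qed.

(** Smooth functions are continuous along coordinate lines; this is how division
    by a function that is only known to be nonzero over I becomes possible on a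
    whole neighbourhood. *)
Lemma line_open_neq0 (Om : R -> R -> Prop) f :
  line_open Om -> smooth2 Om f -> line_open (fun t u => Om t u /\ f t u != 0).
Proof.
move=> Oo sf t u [Ot ft]; have [Ot1 Ot2] := Oo t u Ot.
have := smooth2_has_partial 0 sf Ot; rewrite /has_partial eqxx => /near_neq0/(_ ft) n0.
have := smooth2_has_partial 1 sf Ot; rewrite /has_partial /= => /near_neq0/(_ ft) n1.
by split; near=> x; split; near: x.
Unshelve. all: by end_near. Qed.

Variable Om : R -> R -> Prop.
Hypothesis Om_open : line_open Om.

Definition vsmooth v : Prop := forall k, smooth2 Om (fun t u => v t u 0 k).

Lemma vsmoothD v w : vsmooth v -> vsmooth w -> vsmooth (fun t u => v t u + w t u).
Proof.
move=> sv sw k; apply: smooth2_eq (smooth2D Om_open (sv k) (sw k)) => // t u _.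
by rewrite coordD.
Qed.

Lemma vsmoothZ f v : smooth2 Om f -> vsmooth v -> vsmooth (fun t u => f t u *: v t u).
Proof.
move=> sf sv k; apply: smooth2_eq (smooth2M Om_open sf (sv k)) => // t u _.
by rewrite coordZ.
Qed.

Lemma smooth2_dot v w :
  vsmooth v -> vsmooth w -> smooth2 Om (fun t u => dot (v t u) (w t u)).
Proof. by move=> sv sw; apply: smooth2_sum => // k; apply: smooth2M. Qed.

Lemma vsmooth_cross v w :
  vsmooth v -> vsmooth w -> vsmooth (fun t u => cross (v t u) (w t u)).
Proof.
move=> sv sw k.
apply: smooth2_eq (smooth2D Om_open (smooth2M Om_open (sv (ordS k)) (sw (ord_pred k)))
  (smooth2N Om_open (smooth2M Om_open (sv (ord_pred k)) (sw (ordS k))))) => // t u _.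
by rewrite mxE.
Qed.

Lemma vsmooth_derivable (a : R -> 'rV[R]_3) t u :
  vsmooth (fun x _ => a x) -> Om t u -> derivable a t 1.
Proof.
move=> sa Ot; apply/derivable_mxP => i k; rewrite ord1.
by have [] := smooth2_has_partial 0 (sa k) Ot.
Qed.

Lemma vsmooth_derive1 (a : R -> 'rV[R]_3) :
  vsmooth (fun t _ => a t) -> vsmooth (fun t _ => derive1 a t).
Proof.
move=> sa k; apply: smooth2_eq (smooth2_partial 0 (sa k)) => // t u Ot.
by rewrite /partial eqxx !derive1E derive_mx ?mxE//; apply: vsmooth_derivable sa Ot.
Qed.

Lemma smooth2_is_derive (f : R -> R) t u :
  smooth2 Om (fun x _ => f x) -> Om t u -> is_derive t 1 f (derive1 f t).
Proof. by move=> sf /(smooth2_has_partial 0 sf). Qed.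

Lemma smooth2_derive1 (f : R -> R) :
  smooth2 Om (fun t _ => f t) -> smooth2 Om (fun t _ => derive1 f t).
Proof. by move=> /(smooth2_partial 0). Qed.

End SmoothVectors.

Section Curves.
Variable R : realType.
Implicit Types (a b : R -> 'rV[R]_3) (t : R).

Lemma derive1_coord a t k : derivable a t 1 ->
  is_derive t 1 (fun x => a x 0 k) (derive1 a t 0 k).
Proof.
move=> da; apply: DeriveDef; first by move/derivable_mxP: da.
by rewrite derive1E derive_mx// mxE.
Qed.

Lemma derive1_vec a t (d : 'rV[R]_3) :
  (forall k, is_derive t 1 (fun x => a x 0 k) (d 0 k)) -> derive1 a t = d.
Proof.
move=> da; rewrite derive1E derive_mx.
  by apply/rowP => k; rewrite mxE; have [_ ->] := da k.
by apply/derivable_mxP => i k; rewrite ord1; have [] := da k.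
Qed.

Lemma is_derive_dot a b t : derivable a t 1 -> derivable b t 1 ->
  is_derive t 1 (fun x => dot (a x) (b x)) (dot (derive1 a t) (b t) + dot (a t) (derive1 b t)).
Proof.
move=> da db.
have H k := is_deriveM (derive1_coord k da) (derive1_coord k db).
have -> : (fun x => dot (a x) (b x)) =
   (\sum_(k < 3) ((fun x => a x 0 k) * (fun x => b x 0 k))).
  by apply/funext => x; rewrite fct_sumE.
apply: is_derive_eq1 (is_derive_sum H) _; rewrite -big_split; apply: eq_bigr => k _ /=.
by rewrite addrC; congr (_ + _); rewrite mulrC.
Qed.

Variable I : set R.
Hypothesis hI : nondegenerate_interval I.

Lemma derive1_vec_unique_within a b t : I t ->
  derivable a t 1 -> derivable b t 1 -> (forall x, I x -> a x = b x) ->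
  derive1 a t = derive1 b t.
Proof.
move=> It da db ab; apply: derive1_vec => k.
have ak := derive1_coord k da; have bk := derive1_coord k db.
apply: (is_derive_eq1 ak); rewrite -(derive1_val ak) -(derive1_val bk).
apply: (derive1_unique_within hI It); try by [case: ak|case: bk].
by apply: (@filterE _ (nbhs t)) => x Ix; rewrite ab.
Qed.

(** Leibniz' rule for a relation that is only known on I; it yields each of the
    orthogonality relations obtained by differentiation. *)
Lemma dot_derive1_constant a b t c : I t ->
  derivable a t 1 -> derivable b t 1 -> (forall x, I x -> dot (a x) (b x) = c) ->
  dot (derive1 a t) (b t) + dot (a t) (derive1 b t) = 0.
Proof.
move=> It da db abc; have dab := is_derive_dot da db.
have dc := is_derive_cst c t (1 : R).
rewrite -(derive1_val dab) -(derive1_val dc).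
apply: (derive1_unique_within hI It); try by [case: dab|case: dc].
by apply: (@filterE _ (nbhs t)) => x /abc.
Qed.

End Curves.

(** * The geometry of the ruled surface *)

Section RuledSurface.
Variables (R : realType) (I U : set R) (a b : R -> 'rV[R]_3) (lam : R -> R).
Hypothesis hI : nondegenerate_interval I.
Hypothesis U_open : open U.
Hypothesis IU : I `<=` U.
Hypothesis da : forall n t, U t -> derivable (derive1n n a) t 1.
Hypothesis db : forall n t, U t -> derivable (derive1n n b) t 1.
Hypothesis b_sphere : spherical I b.
Hypothesis b_arclength : unit_speed I b.
Hypothesis ab_orth : orthogonal_curves I a b.
Hypothesis hlam : distribution_parameter I a b lam.

Let A := derive1 a.
Let B := derive1 b.

Lemma dot_bb t : I t -> dot (b t) (b t) = 1.
Proof. by move=> It; rewrite -enorm_sq b_sphere// expr1n. Qed.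

Lemma dot_BB t : I t -> dot (B t) (B t) = 1.
Proof. by move=> It; rewrite -enorm_sq b_arclength// expr1n. Qed.

Lemma dot_Bb t : I t -> dot (B t) (b t) = 0.
Proof.
move=> It; have := dot_derive1_constant hI It (@db 0 _ (IU It)) (@db 0 _ (IU It)) dot_bb.
rewrite [dot (b t) _]dotC -/B => e; lra.
Qed.

(** Lagrange's identity for alpha' x beta = lam beta'. *)
Lemma dot_AA t : I t -> dot (A t) (A t) = dot (A t) (b t) ^+ 2 + lam t ^+ 2.
Proof.
move=> It; have := dot_cross_cross (A t) (b t).
by rewrite hlam// dotZl dotZr -/B dot_BB// dot_bb// !mulr1 -expr2 => ->; rewrite addrC subrK.
Qed.

Lemma distribution_parameterE t : I t -> lam t = dot (cross (A t) (b t)) (B t).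
Proof. by move=> It; rewrite hlam// dotZl -/B dot_BB// mulr1. Qed.

Lemma partial_ruled t u : U t ->
  partial 0 (ruled a b) t u = A t + u *: B t /\ partial 1 (ruled a b) t u = b t.
Proof.
move=> Ut; have dat := @da 0 _ Ut; have dbt := @db 0 _ Ut.
have XE x y k : ruled a b x y 0 k = a x 0 k + y * b x 0 k.
  by rewrite coordD coordZ.
split; rewrite /partial /=; apply: derive1_vec => k.
- rewrite (_ : (fun x => _) = fun x => a x 0 k + u * b x 0 k); last first.
    by apply/funext => x; rewrite XE.
  apply: is_derive_eq1.
    apply: (is_deriveD (derive1_coord k dat)).
    exact: (is_deriveZ u (derive1_coord k dbt)).
  by rewrite coordD coordZ.
- rewrite (_ : (fun y => _) = fun y => a t 0 k + y * b t 0 k); last first.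
    by apply/funext => y; rewrite XE.
  have d : has_partial 1 (fun x y => a x 0 k + y * b x 0 k) t u _ :=
    has_partialD (has_partial_fst1 _ _ _)
      (has_partialM (has_partial_snd1 _ _) (has_partial_fst1 _ _ _)).
  by apply: (is_derive_eq1 d); rewrite /= mul1r mulr0 addr0 add0r.
Qed.

Lemma induced_metric_ruled t u : U t ->
  [/\ induced_metric (ruled a b) t u 0 0 = dot (A t + u *: B t) (A t + u *: B t),
      induced_metric (ruled a b) t u 0 1 = dot (A t + u *: B t) (b t),
      induced_metric (ruled a b) t u 1 0 = dot (b t) (A t + u *: B t) &
      induced_metric (ruled a b) t u 1 1 = dot (b t) (b t)].
Proof. by move=> /(partial_ruled u)[X0 X1]; rewrite !mxE !X0 !X1. Qed.

Let Om0 (t u : R) : Prop := U t.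

Lemma line_open_strip : line_open Om0.
Proof.
move=> t u Ut; split; last by apply: (@filterE _ (nbhs u)).
exact: open_nbhs_nbhs.
Qed.
Local Notation op := line_open_strip.

Lemma vsmooth_strip n :
  vsmooth Om0 (fun t _ => derive1n n a t) /\ vsmooth Om0 (fun t _ => derive1n n b t).
Proof. by split=> k; apply: (smooth2_coord op (U := U)). Qed.

Lemma smooth2_induced_metric i j :
  smooth2 Om0 (fun t u => induced_metric (ruled a b) t u i j).
Proof.
have [_ sb] := vsmooth_strip 0; have [sA sB] := vsmooth_strip 1.
have sX : vsmooth Om0 (fun t u => A t + u *: B t).
  by apply: (vsmoothD op sA); apply: (vsmoothZ op (smooth2_snd op)).
case: (ord2P i) => ->; case: (ord2P j) => ->.
- by apply: (smooth2_eq op _ (smooth2_dot op sX sX)) => t u /(induced_metric_ruled u)[-> _ _ _].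
- by apply: (smooth2_eq op _ (smooth2_dot op sX sb)) => t u /(induced_metric_ruled u)[_ -> _ _].
- by apply: (smooth2_eq op _ (smooth2_dot op sb sX)) => t u /(induced_metric_ruled u)[_ _ -> _].
- by apply: (smooth2_eq op _ (smooth2_dot op sb sb)) => t u /(induced_metric_ruled u)[_ _ _ ->].
Qed.

Lemma induced_metric_on t u : I t ->
  [/\ induced_metric (ruled a b) t u 0 0 = dot (A t) (b t) ^+ 2 + lam t ^+ 2 + u ^+ 2,
      induced_metric (ruled a b) t u 0 1 = dot (A t) (b t),
      induced_metric (ruled a b) t u 1 0 = dot (A t) (b t) &
      induced_metric (ruled a b) t u 1 1 = 1].
Proof.
move=> It; have [-> -> -> ->] := induced_metric_ruled u (IU It).
rewrite [dot (b t) _]dotC !dotDl !dotDr !dotZl !dotZr dot_bb// dot_Bb// dot_BB// dot_AA//.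
have AB0 : dot (A t) (B t) = 0 by apply: ab_orth.
by rewrite [dot (B t) (A t)]dotC AB0 !(mulr0, mulr1, addr0, add0r) expr2.
Qed.

(** F and L may be any smooth extensions of <alpha', beta> and of the distribution
    parameter: the canonical ones serve to derive F = L' = 0 from the Ricci
    condition, constant ones to verify it. *)
Lemma ricci_defect_ruled (F L : R -> R) t u :
  smooth2 Om0 (fun x _ => F x) -> smooth2 Om0 (fun x _ => L x) ->
  (forall x, I x -> F x = dot (A x) (b x)) -> (forall x, I x -> L x = lam x) ->
  I t -> lam t != 0 ->
  ricci_defect (induced_metric (ruled a b)) t u =
  lam t ^+ 2 * (L t * L t + u * u)^-1 ^+ 7 *
  ricci_polynomial (lam t) (derive1 L t) (derive1 (derive1 L) t) (F t) (derive1 F t) u.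
Proof.
move=> sF sL FE LE It lt0; set g := induced_metric _.
(* Both determinants are nonzero near (t, u), where the metrics need not agree. *)
pose D x y := \det (g x y) * (L x * L x + y * y).
have sD : smooth2 Om0 D.
  apply: (smooth2M op); last first.
    by apply: (smooth2D op); apply: (smooth2M op) => //; apply: (smooth2_snd op).
  apply: (smooth2_eq op _ (smooth2D op
    (smooth2M op (smooth2_induced_metric 0 0) (smooth2_induced_metric 1 1))
    (smooth2N op (smooth2M op (smooth2_induced_metric 0 1) (smooth2_induced_metric 1 0))))).
  by move=> x y _; rewrite -det2.
pose Om x y := Om0 x y /\ D x y != 0.
have Om_open : line_open Om by apply: (line_open_neq0 op sD).
have sub x y : Om x y -> Om0 x y by case.
have D0 x y : Om x y -> L x * L x + y * y != 0.
  by move=> [_]; rewrite mulf_eq0 => /norP[].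
have g0 x y : Om x y -> \det (g x y) != 0.
  by move=> [_]; rewrite mulf_eq0 => /norP[].
have sF' := smooth2_mono sub sF; have sL' := smooth2_mono sub sL.
have sL1 := smooth2_derive1 sL'.
have cgh i j : congruent I Om (fun x y => g x y i j) (fun x y => ruled_metric F L x y i j).
  split.
  - exact: smooth2_mono sub (smooth2_induced_metric i j).
  - have [h1 h2 h3 h4] := ruled_metricE F L.
    have sFF := smooth2M Om_open sF' sF'; have sLL := smooth2M Om_open sL' sL'.
    have suu := smooth2M Om_open (smooth2_snd Om_open) (smooth2_snd Om_open).
    case: (ord2P i) => ->; case: (ord2P j) => ->; rewrite ?h1 ?h2 ?h3 ?h4 //.
    + by apply: (smooth2D Om_open) => //; apply: (smooth2D Om_open).
    + exact: smooth2_cst.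
  - move=> x y Ix _; have [m1 m2 m3 m4] := induced_metric_on y Ix.
    by case: (ord2P i) => ->; case: (ord2P j) => ->;
      rewrite /g ?m1 ?m2 ?m3 ?m4 mxE /= ?FE// LE.
have Ot : Om t u.
  split; first exact: IU.
  have [m1 m2 m3 m4] := induced_metric_on u It.
  rewrite /D det2 /g m1 m2 m3 m4 LE//.
  rewrite (_ : _ - _ = lam t ^+ 2 + u ^+ 2); last by ring.
  rewrite -!expr2.
  by rewrite mulf_neq0// gt_eqF// ltr_wpDr ?sqr_ge0// exprn_even_gt0.
rewrite (ricci_defect_congruent hI Om_open cgh g0 _ It Ot); last first.
  by move=> x y Oxy; rewrite det_ruled_metric D0.
have dF x y : Om x y -> is_derive x 1 F (derive1 F x) by apply: smooth2_is_derive.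
have dL x y : Om x y -> is_derive x 1 L (derive1 L x) by apply: smooth2_is_derive.
have dL1 x y : Om x y -> is_derive x 1 (derive1 L) (derive1 (derive1 L) x).
  exact: smooth2_is_derive.
by rewrite (ricci_defect_ruled_metric Om_open dF dL dL1 D0 Ot) LE.
Qed.

End RuledSurface.

(** * The Frenet frame and the director curve *)

Section Frenet.
Variables (R : realType) (Om : R -> R -> Prop) (a : R -> 'rV[R]_3).
Hypothesis Om_open : line_open Om.
Hypothesis a_smooth : vsmooth Om (fun t _ => a t).
Hypothesis a_regular : forall t u, Om t u -> derive1 a t != 0.

(** The derivative of t |-> s, for the arc length parameter s selected by o. *)
Definition velocity (o : bool) t : R := (-1) ^+ o * enorm (derive1 a t).

Lemma velocity_sq o t : velocity o t ^+ 2 = dot (derive1 a t) (derive1 a t).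
Proof. by rewrite exprMn sqrr_sign mul1r enorm_sq. Qed.

Lemma velocity_neq0 o t u : Om t u -> velocity o t != 0.
Proof. by move=> /a_regular; rewrite -dotvv_eq0 -(velocity_sq o) sqrf_eq0. Qed.

Lemma derive1_velocity o t u :
  Om t u -> derive1 a t = velocity o t *: tangent o a t.
Proof. by move=> Ot; rewrite scalerA mulfV ?scale1r//; apply: velocity_neq0 Ot. Qed.

Lemma vsmooth_ds o f :
  vsmooth Om (fun t _ => f t) -> vsmooth Om (fun t _ => ds o a f t).
Proof.
move=> sf; apply: (vsmoothZ Om_open); last exact: vsmooth_derive1.
apply: (smooth2V Om_open); first by move=> t u; apply: velocity_neq0.
apply: (smooth2M Om_open); first exact: smooth2_cst.
have sA := vsmooth_derive1 Om_open a_smooth.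
apply: (smooth2_sqrt Om_open) (smooth2_dot Om_open sA sA) => t u Ot.
by rewrite lt_neqAle dotvv_ge0 eq_sym dotvv_eq0 (a_regular Ot).
Qed.

Lemma vsmooth_tangent o : vsmooth Om (fun t _ => tangent o a t).
Proof. exact: vsmooth_ds. Qed.

Lemma dot_tangent o t u : Om t u -> dot (tangent o a t) (tangent o a t) = 1.
Proof.
move=> Ot; have v0 := velocity_neq0 o Ot.
rewrite dotZl dotZr -(velocity_sq o) -/(velocity o t); by field.
Qed.

Lemma dot_tangent_derive o t u :
  Om t u -> dot (tangent o a t) (derive1 (tangent o a) t) = 0.
Proof.
move=> Ot; have dT := vsmooth_derivable (vsmooth_tangent o) Ot.
have := is_derive_dot dT dT.
have /near_eq_is_derive H : \forall x \near t, cst 1 x = dot (tangent o a x) (tangent o a x).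
  by have [Ot1 _] := Om_open Ot; apply: filterS Ot1 => x /(dot_tangent o).
have := H _ _ (is_derive_cst (1 : R) t (1 : R)) => /derive1_val e /derive1_val.
rewrite e [dot (derive1 _ _) _]dotC => e2; lra.
Qed.

(** Reversing the arc length changes the sign of both derivations in d^2/ds^2. *)
Lemma ds_tangent_orientation t u : Om t u ->
  ds true a (tangent true a) t = ds false a (tangent false a) t.
Proof.
move=> Ot; have dT := vsmooth_derivable (vsmooth_tangent false) Ot.
have dsN (f : R -> 'rV[R]_3) x : ds true a f x = - ds false a f x.
  by rewrite /ds expr1 expr0 mul1r mulN1r invrN scaleNr.
have -> : tangent true a = - tangent false a.
  by apply/funext => x; rewrite /tangent dsN.
by rewrite dsN /ds !derive1E deriveN// scalerN opprK.
Qed.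

Lemma normal_orientation t u : Om t u -> normal true a t = normal false a t.
Proof. by move=> Ot; rewrite /normal /curvature (ds_tangent_orientation Ot). Qed.

Lemma binormal_orientation t u :
  Om t u -> binormal true a t = - binormal false a t.
Proof.
move=> Ot; rewrite /binormal (normal_orientation Ot) -crossNl; congr cross.
by rewrite /tangent /ds expr1 expr0 mul1r mulN1r invrN scaleNr.
Qed.

Hypothesis a_curved : forall t u, Om t u -> curvature false a t != 0.

Lemma curvature_neq0 o t u : Om t u -> curvature o a t != 0.
Proof.
move=> Ot; case: o; last exact: a_curved Ot.
by rewrite /curvature (ds_tangent_orientation Ot); exact: a_curved Ot.
Qed.

Lemma vsmooth_normal o : vsmooth Om (fun t _ => normal o a t).
Proof.
have sT := vsmooth_ds o (vsmooth_tangent o).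
apply: (vsmoothZ Om_open) => //.
apply: (smooth2V Om_open); first by move=> t u; apply: curvature_neq0.
apply: (smooth2_sqrt Om_open) (smooth2_dot Om_open sT sT) => t u Ot.
by rewrite lt_neqAle dotvv_ge0 eq_sym dotvv_eq0 -enorm_eq0 (curvature_neq0 o Ot).
Qed.

Lemma vsmooth_binormal o : vsmooth Om (fun t _ => binormal o a t).
Proof. exact: vsmooth_cross (vsmooth_tangent o) (vsmooth_normal o). Qed.

Lemma dot_normal o t u : Om t u -> dot (normal o a t) (normal o a t) = 1.
Proof.
move=> Ot; have k0 := curvature_neq0 o Ot.
rewrite dotZl dotZr -enorm_sq -/(curvature o a t); by field.
Qed.

Lemma dot_tangent_normal o t u : Om t u -> dot (tangent o a t) (normal o a t) = 0.
Proof. by move=> Ot; rewrite !dotZr (dot_tangent_derive o Ot) !mulr0. Qed.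

Lemma dot_binormal o t u : Om t u -> dot (binormal o a t) (binormal o a t) = 1.
Proof.
move=> Ot; rewrite dot_cross_cross (dot_tangent o Ot) (dot_normal o Ot).
by rewrite (dot_tangent_normal o Ot) mulr1 expr0n subr0.
Qed.

End Frenet.

Section Director.
Variables (R : realType) (I : set R) (Om : R -> R -> Prop).
Variables (a b : R -> 'rV[R]_3) (lam : R -> R).
Hypothesis hI : nondegenerate_interval I.
Hypothesis Om_open : line_open Om.
Hypothesis IOm : forall t, I t -> Om t 0.
Hypothesis a_smooth : vsmooth Om (fun t _ => a t).
Hypothesis b_smooth : vsmooth Om (fun t _ => b t).
Hypothesis a_regular : forall t u, Om t u -> derive1 a t != 0.
Hypothesis a_curved : forall t u, Om t u -> curvature false a t != 0.
Hypothesis b_sphere : spherical I b.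
Hypothesis ab_orth : orthogonal_curves I a b.
Hypothesis hlam : distribution_parameter I a b lam.

(** Since T x B = - N, the relation alpha' x beta = lam beta' with beta = B says
    that lam beta' = - v N, where v = ds/dt, while tau = <beta', N> / v. *)
Lemma binormal_director o : (forall t, I t -> b t = binormal o a t) ->
  forall t, I t ->
    dot (derive1 a t) (b t) = 0 /\ lam t * torsion o a t = -1.
Proof.
move=> bB t It; have Ot := IOm It.
have AT := derive1_velocity a_regular o Ot.
split; first by rewrite bB// AT dotZl dot_cross mulr0.
have TT := dot_tangent a_regular o Ot.
have TN := dot_tangent_normal Om_open a_smooth a_regular o Ot.
have NN := dot_normal Om_open a_smooth a_regular a_curved o Ot.
have v0 := velocity_neq0 a_regular o Ot.
have db := vsmooth_derivable b_smooth Ot.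
have dB := vsmooth_derivable (vsmooth_binormal Om_open a_smooth a_regular a_curved o) Ot.
have B' := derive1_vec_unique_within hI It db dB bB.
have lb : lam t *: derive1 b t = - (velocity a o t *: normal o a t).
  by rewrite -hlam// bB// {1}AT crossZl double_cross TN TT scale0r scale1r sub0r scalerN.
rewrite /torsion /ds -B' -/(velocity a o t) dotZl mulrCA -dotZl lb -scaleNr dotZl NN mulr1.
by rewrite mulrN mulVf.
Qed.

(** Being orthogonal to T and N, beta is delta B with delta^2 = 1.  The sign delta is
    differentiable, so it is constant on I, and reversing the arc length turns
    B into - B. *)
Lemma director_binormal :
  (forall t, I t -> dot (derive1 a t) (b t) = 0) ->
  exists o, forall t, I t -> b t = binormal o a t.
Proof.
move=> ab0.
pose T := tangent false a; pose N := normal false a; pose B := binormal false a.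
have Tb t : I t -> dot (T t) (b t) = 0 by move=> It; rewrite dotZl ab0 ?mulr0.
have db t (It : I t) := vsmooth_derivable b_smooth (IOm It).
have dB t (It : I t) := vsmooth_derivable
  (vsmooth_binormal Om_open a_smooth a_regular a_curved false) (IOm It).
have dT t (It : I t) := vsmooth_derivable
  (vsmooth_tangent Om_open a_smooth a_regular false) (IOm It).
have Nb t : I t -> dot (N t) (b t) = 0.
  move=> It; have := dot_derive1_constant hI It (dT t It) (db t It) Tb.
  by rewrite !dotZl ab_orth// mulr0 addr0 => ->; rewrite !mulr0.
pose delta t := dot (b t) (B t).
have bE t : I t -> b t = delta t *: B t.
  move=> It; have Ot := IOm It; apply: parallel_cross.
  - exact: dot_tangent a_regular false t 0 Ot.
  - exact: dot_normal Om_open a_smooth a_regular a_curved false t 0 Ot.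
  - exact: dot_tangent_normal Om_open a_smooth a_regular false t 0 Ot.
  - by rewrite dotC Tb.
  - by rewrite dotC Nb.
have delta2 t : I t -> delta t ^+ 2 = 1.
  move=> It; have := b_sphere It => /(congr1 (fun x => x ^+ 2)).
  rewrite enorm_sq (bE _ It) dotZl dotZr expr1n => <-.
  by rewrite (dot_binormal Om_open a_smooth a_regular a_curved false (IOm It)) mulr1 expr2.
have ddelta t : I t -> is_derive t 1 delta 0.
  move=> It; have d := is_derive_dot (db t It) (dB t It).
  have d2 := is_deriveM d d; have d1 := is_derive_cst (1 : R) t (1 : R).
  have := derive1_unique_within hI It (ex_derive (is_derive := d2)) (ex_derive (is_derive := d1)).
  rewrite (derive1_val d2) (derive1_val d1) => e.
  apply: (is_derive_eq1 d).
  have dt0 : delta t != 0 by rewrite -sqrf_eq0 delta2// oner_eq0.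
  apply: (mulfI dt0); rewrite mulr0.
  have : delta t * (dot (derive1 b t) (B t) + dot (b t) (derive1 B t)) *+ 2 = 0.
    rewrite mulr2n; apply: e; apply: (@filterE _ (nbhs t)) => x Ix.
    by rewrite -(delta2 _ Ix) expr2.
  by move/eqP; rewrite mulrn_eq0 /= => /eqP.
have [iI [t0 /interior_subset It0]] := hI.
have dc t : I t -> delta t = delta t0.
  by move=> It; apply: (zero_derive1_constant iI ddelta).
have /eqP := delta2 _ It0; rewrite sqrf_eq1 => /orP[] /eqP d0.
- by exists false => t It; rewrite [LHS]bE// dc// d0 scale1r.
- exists true => t It; rewrite (binormal_orientation Om_open a_smooth a_regular (IOm It)).
  by rewrite [LHS]bE// dc// d0 scaleN1r.
Qed.

End Director.

Section FrenetDomain.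
Variables (R : realType) (I U : set R) (a b : R -> 'rV[R]_3).
Hypothesis U_open : open U.
Hypothesis IU : I `<=` U.
Hypothesis da : forall n t, U t -> derivable (derive1n n a) t 1.
Hypothesis db : forall n t, U t -> derivable (derive1n n b) t 1.
Hypothesis a_regular : regular I a.
Hypothesis a_curved : forall t, I t -> curvature false a t != 0.

(** Regularity and nonvanishing curvature, assumed on I, persist near I; there the
    Frenet frame is smooth, and can be differentiated from both sides at the
    endpoints of I. *)
Lemma frenet_domain : exists Om,
  [/\ line_open Om, (forall t, I t -> Om t 0),
      vsmooth Om (fun t _ => a t) /\ vsmooth Om (fun t _ => b t),
      (forall t u, Om t u -> derive1 a t != 0) &
      (forall t u, Om t u -> curvature false a t != 0)].
Proof.
have op := line_open_strip U_open.
have [sa sb] := vsmooth_strip U_open da db 0.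
have sA := vsmooth_derive1 op sa.
pose Om1 (t u : R) := U t /\ dot (derive1 a t) (derive1 a t) != 0.
have op1 : line_open Om1 := line_open_neq0 op (smooth2_dot op sA sA).
have sub1 t u : Om1 t u -> U t by case.
have reg1 t u : Om1 t u -> derive1 a t != 0 by case; rewrite dotvv_eq0.
have sa1 : vsmooth Om1 (fun t _ => a t) by move=> k; apply: smooth2_mono (sa k).
have sdT := vsmooth_ds op1 sa1 reg1 false (vsmooth_tangent op1 sa1 reg1 false).
exists (fun t u => Om1 t u /\
  dot (ds false a (tangent false a) t) (ds false a (tangent false a) t) != 0).
split.
- exact: line_open_neq0 op1 (smooth2_dot op1 sdT sdT).
- move=> t It; split; first by split; [exact: IU|rewrite dotvv_eq0 a_regular].
  by rewrite dotvv_eq0 -enorm_eq0 a_curved.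
- split=> k.
    by apply: smooth2_mono (sa k) => t u [[]].
  by apply: smooth2_mono (sb k) => t u [[]].
- by move=> t u [/reg1].
- by move=> t u [_]; rewrite dotvv_eq0 -enorm_eq0.
Qed.

End FrenetDomain.

(** * The classification *)

Theorem theorem2 (R : realType) (I J : set R) (alpha beta : R -> 'rV[R]_3)
    (lam : R -> R)
    (hI : nondegenerate_interval I) (hJ : nondegenerate_interval J)
    (smooth_alpha : smooth_on I alpha) (smooth_beta : smooth_on I beta)
    (immersed : immersion I J (ruled alpha beta))
    (beta_sphere : spherical I beta) (beta_arclength : unit_speed I beta)
    (orth : orthogonal_curves I alpha beta)
    (hlam : distribution_parameter I alpha beta lam)
    (nondev : ~ developable I lam)
    (alpha_regular : regular I alpha)
    (alpha_curved : forall t : R, I t -> curvature false alpha t != 0) :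
  (ricci_surface I J (ruled alpha beta) <->
     exists tau0 : R, binormal_of_constant_torsion I alpha beta tau0)
  /\
  (forall tau0 : R, binormal_of_constant_torsion I alpha beta tau0 ->
     exists lam0 : R,
       (forall t : R, I t -> lam t = lam0) /\ (lam0 * tau0) ^+ 2 = 1).
Proof.
have [U1 [oU1 IU1 dU1]] := smooth_alpha; have [U2 [oU2 IU2 dU2]] := smooth_beta.
pose U := U1 `&` U2.
have oU : open U by exact: openI.
have IU : I `<=` U by move=> t It; split; [exact: IU1|exact: IU2].
have da n t : U t -> derivable (derive1n n alpha) t 1 by case=> /dU1.
have db n t : U t -> derivable (derive1n n beta) t 1 by case=> _ /dU2.
have [Om [Oo IOm [sa sb] reg curved]] := frenet_domain oU IU da db alpha_regular alpha_curved.
have lam_torsion tau0 : binormal_of_constant_torsion I alpha beta tau0 ->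
    tau0 != 0 /\ forall t, I t ->
      dot (derive1 alpha t) (beta t) = 0 /\ lam t = - tau0^-1.
  move=> [tau0_neq0 [ori tauB]]; split=> // t It.
  have [|ab0 lt] := @binormal_director _ I Om alpha beta lam hI Oo IOm sa sb reg curved hlam ori _ t It.
    by move=> x /tauB[].
  split=> //; have [tauE _] := tauB t It; rewrite tauE in lt.
  by apply: (mulIf tau0_neq0); rewrite lt mulNr mulVf.
split; last first.
  move=> tau0 /lam_torsion[tau0_neq0 lamE]; exists (- tau0^-1).
  by split; [move=> t /lamE[]|rewrite mulNr mulVf// sqrrN expr1n].
have ricciE := ricci_defect_ruled hI oU IU da db beta_sphere beta_arclength orth hlam.
have op := line_open_strip oU.
split=> [ricci|[tau0 /lam_torsion[tau0_neq0 lamE]]]; last first.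
  move=> t u It Ju; have [_ lt] := lamE t It.
  have lt0 : lam t != 0 by rewrite lt oppr_eq0 invr_eq0.
  have := ricciE (fun=> 0) (fun=> - tau0^-1) t u (smooth2_cst op _) (smooth2_cst op _) _ _ It lt0.
  rewrite /ricci_defect => ->.
  - have d0 (c : R) : derive1 (fun=> c) = (fun=> 0) :> (R -> R).
      by apply/funext => x; exact: (derive1_val (is_derive_cst c x (1 : R))).
    by rewrite !d0 /ricci_polynomial; ring.
  - by move=> x /lamE[].
  - by move=> x /lamE[].
(* This formula for the distribution parameter makes sense, and is smooth, near I. *)
pose F t := dot (derive1 alpha t) (beta t).
pose L t := dot (cross (derive1 alpha t) (beta t)) (derive1 beta t).
have [sa0 sb0] := vsmooth_strip oU da db 0.
have sA := vsmooth_derive1 op sa0; have sB := vsmooth_derive1 op sb0.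
have sF : smooth2 (fun t _ => U t) (fun t _ => F t) := smooth2_dot op sA sb0.
have sAb : vsmooth (fun t _ => U t) (fun t _ => cross (derive1 alpha t) (beta t)).
  exact: (vsmooth_cross op sA sb0).
have sL : smooth2 (fun t _ => U t) (fun t _ => L t) := smooth2_dot op sAb sB.
have LE t : I t -> L t = lam t by move=> It; rewrite (distribution_parameterE beta_arclength hlam It).
have rigid t : I t -> L t != 0 -> derive1 L t = 0 /\ F t = 0.
  move=> It Lt0; have lt0 : lam t != 0 by rewrite -LE.
  apply: (@ricci_polynomial_vanishing _ J (lam t) _ (derive1 (derive1 L) t) _ (derive1 F t)) => // u Ju.
  have : ricci_defect (induced_metric (ruled alpha beta)) t u = 0 := ricci t u It Ju.
  rewrite (ricciE F L)// => /eqP.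
  have D0 : L t * L t + u * u != 0.
    by rewrite -!expr2 gt_eqF// ltr_wpDr ?sqr_ge0// exprn_even_gt0.
  by rewrite mulf_eq0 (negPf (mulf_neq0 _ _)) ?expf_neq0 ?invr_eq0//= => /eqP.
have dL t (It : I t) : is_derive t 1 L (derive1 L t) := smooth2_is_derive (u := 0) sL (IU t It).
(* (L^2)' = 2 L L' vanishes on I: either L = 0 or L' = 0. *)
have L2cst s t : I s -> I t -> L s ^+ 2 = L t ^+ 2.
  apply: (@zero_derive1_constant _ I (fun x => L x ^+ 2)) => [|x Ix]; first by case: hI.
  have := is_deriveM (dL x Ix) (dL x Ix) => d.
  apply: (is_derive_eq1 d).
  have [->|/(rigid x Ix)[-> _]] := eqVneq (L x) 0; last by rewrite scaler0 addr0.
  by rewrite !scale0r addr0.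
have L0 t : I t -> L t != 0.
  move=> It; apply: contra_notN nondev => /eqP Lt0 s Is.
  by apply/eqP; rewrite -LE// -sqrf_eq0 (L2cst s t)// Lt0 expr0n.
have F0 t : I t -> F t = 0 by move=> It; have [] := rigid t It (L0 t It).
have [iI [t0 /interior_subset It0]] := hI.
have Lcst t : I t -> L t = L t0.
  move=> It; apply: (zero_derive1_constant iI _ It It0) => x Ix.
  by have [<- _] := rigid x Ix (L0 x Ix); apply: dL.
exists (- (L t0)^-1); split; first by rewrite oppr_eq0 invr_eq0 L0.
have [ori oB] := director_binormal hI Oo IOm sa sb reg curved beta_sphere orth F0.
exists ori => t It; split; last exact: oB.
have [_ lt] := binormal_director hI Oo IOm sa sb reg curved hlam oB It.
by apply: (mulfI (L0 _ It)); rewrite {1}LE// lt -(Lcst t It) mulrN mulfV// L0.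
Qed.
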